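(* Let $k\ge 2$ and $n\ge 1$ be integers, let $t=(t_1,\dots,t_k)$ be complex numbers with $t_2\neq 0$, and put $t_0=1$. Let $L_{k,n}=(l_{ij})$ be the $n\times n$ lower Hessenberg matrix with $$l_{ij}=\begin{cases}\dfrac{t_{i-j+1}}{t_2^{\,i-j}} & \text{if } j\neq 1 \text{ and } -1\le i-j<k,\\[2mm] \dfrac{t_{i-j+1}}{t_2^{\,i-j}}\,(i-j+1) & \text{if } j=1 \text{ and } -1\le i-j<k,\\[2mm] 0 & \text{otherwise.}\end{cases}$$ Then $\operatorname{per}(L_{k,n})=G_{k,n}(t)$, where $G_{k,n}(t)$ is the generalized Lucas polynomial.
   Context: The permanent of an $n\times n$ matrix $A=(a_{ij})$ is $\operatorname{per}(A)=\sum_{\sigma\in S_n}\prod_{i=1}^n a_{i,\sigma(i)}$. The generalized Fibonacci polynomials $F_{k,n}(t)$, $t=(t_1,\dots,t_k)$, are defined by $F_{k,n}(t)=0$ for $n<1$, $F_{k,1}(t)=1$, and $F_{k,n+1}(t)=t_1F_{k,n}(t)+\cdots+t_kF_{k,n-k+1}(t)$ for $n\ge 1$. The generalized Lucas polynomials are given by $G_{k,0}(t)=k$ and $G_{k,n}(t)=\sum_{j=1}^{k} j\,t_j\,F_{k,n-j+1}(t)$ for $n\ge 1$. A matrix $(a_{ij})$ is lower Hessenberg if $a_{ij}=0$ whenever $j-i>1$. *)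

(* Defs.v *)
From HB Require Import structures.
From mathcomp Require Import all_boot all_order all_fingroup all_algebra.
From mathcomp Require Import reals complex ring.
Set Implicit Arguments.
Unset Strict Implicit.
Unset Printing Implicit Defensive.
Import Order.TTheory GRing.Theory Num.Theory.
Local Open Scope ring_scope.

Definition permanent (C : comNzRingType) (n : nat) (A : 'M[C]_n) : C :=
  \sum_(s : 'S_n) \prod_(i < n) A i (s i).

Definition lower_hessenberg (C : nzRingType) (n : nat) (A : 'M[C]_n) : Prop :=
  forall i j : 'I_n, 1 < j%:Z - i%:Z -> A i j = 0.

(* [coef_t t j] is t_j for 0 <= j <= k, where t = (t_1, ..., t_k) and t_0 = 1;
   the default value of [nth] is reached only for j > k. *)
Definition coef_t (C : comNzRingType) (k : nat) (t : k.-tuple C) (j : nat) : C :=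
  nth 0 (1 :: t) j.

(* [gfib_rev t n] is the list [:: F_{k,n}; F_{k,n-1}; ...; F_{k,0}]; reading it
   past its end gives 0, the value of F_{k,m} for m < 0. *)
Fixpoint gfib_rev (C : comNzRingType) (k : nat) (t : k.-tuple C) (n : nat) :
    seq C :=
  match n with
  | 0%N => [:: 0]
  | 1%N => [:: 1; 0]
  | n'.+1 =>
      let s := gfib_rev t n' in
      (\sum_(1 <= j < k.+1) coef_t t j * nth 0 s j.-1) :: s
  end.

Definition gfib (C : comNzRingType) (k : nat) (t : k.-tuple C) (m : int) : C :=
  match m with
  | Posz n => head 0 (gfib_rev t n)
  | Negz _ => 0
  end.

Definition glucas (C : comNzRingType) (k : nat) (t : k.-tuple C) (n : nat) : C :=
  if n == 0%N then k%:R
  else \sum_(1 <= j < k.+1) j%:R * coef_t t j * gfib t (n%:Z - j%:Z + 1).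

(* Rows and columns are numbered from 0, so the first column is [j = 0].  Under
   the guard -1 <= i - j, the natural number [i.+1 - j] is not truncated; [^]
   is the power with an integer exponent, so the entries above the diagonal
   are t_0 / t_2 ^ (-1). *)
Definition lucas_mx (C : fieldType) (k : nat) (t : k.-tuple C) (n : nat) :
    'M[C]_n :=
  \matrix_(i < n, j < n)
    if (-1 <= i%:Z - j%:Z) && (i%:Z - j%:Z < k%:Z) then
      if j == 0%N :> nat then
        coef_t t (i.+1 - j) / coef_t t 2 ^ (i%:Z - j%:Z) * (i.+1 - j)%:R
      else coef_t t (i.+1 - j) / coef_t t 2 ^ (i%:Z - j%:Z)
    else 0.

Section Conventions.
Variables (C : fieldType) (k : nat) (t : k.-tuple C).

Lemma gfib_le0 (m : int) : m < 1 -> gfib t m = 0.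
Proof. by case: m => [[|n]|n]. Qed.

Lemma gfib1 : gfib t 1 = 1.
Proof. by []. Qed.

Lemma nth_gfib_rev (n i : nat) : nth 0 (gfib_rev t n) i = gfib t (n%:Z - i%:Z).
Proof.
elim: n i => [|n IHn] [|i]; rewrite ?subr0 ?nth0 //.
  by rewrite sub0r -NegzE /= nth_nil.
have -> : n.+1%:Z - i.+1%:Z = n%:Z - i%:Z.
  by rewrite -!natz !mulrS opprD addrACA subrr add0r.
by rewrite -IHn; case: n {IHn}.
Qed.

Lemma gfibS (n : nat) : (1 <= n)%N ->
  gfib t (n%:Z + 1) = \sum_(1 <= j < k.+1) coef_t t j * gfib t (n%:Z - j%:Z + 1).
Proof.
case: n => [//|n] _; rewrite -PoszD addn1 [LHS]/=.
apply: eq_big_nat => -[//|j] _.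
rewrite -[X in _ * X]/(nth 0 (gfib_rev t n.+1) j) nth_gfib_rev.
by congr (_ * gfib t _); rewrite -!natz !mulrS [LHS]addrC; ring.
Qed.

Lemma lucas_mx_hessenberg (n : nat) : lower_hessenberg (lucas_mx t n).
Proof.
move=> i j ltij; rewrite mxE ifF //; apply/negbTE.
by rewrite negb_and -ltNge ltrNr opprB ltij.
Qed.

End Conventions.

(* Main.v *)
Require Import Defs.
From HB Require Import structures.
From mathcomp Require Import all_boot all_order all_fingroup all_algebra.
From mathcomp Require Import reals complex.
From mathcomp Require Import zify.
Set Implicit Arguments.
Unset Strict Implicit.
Unset Printing Implicit Defensive.
Import Order.TTheory GRing.Theory Num.Theory.
Local Open Scope ring_scope.
Local Open Scope complex_scope.

(** Apart from its first column, [lucas_mx] is a Toeplitz matrix: the entry in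
    row [i] and column [j > 0] depends on [i + 1 - j] only.  It is therefore
    natural to study the Hessenberg matrices [hess_mx c b] with a free first
    column [c] and the other columns given by one sequence [b], with [b 0]
    above the diagonal.

    This class is stable under Laplace expansion along the first row, which has
    only two nonzero entries: deleting the first column promotes the second
    one, so [c] becomes the shift of [b], while deleting the second column
    keeps the first one, so [c] becomes the shift of [c]
    ([permanent_hess_mxSS]).  Iterating in [c] gives the permanent as the
    convolution of [c i * b 0 ^+ i] with the permanents of the pure Toeplitz
    matrices [hess_mx (b \o succn) b m] ([permanent_hess_mx]).

    For the sequence [b m = t_m / t_2 ^ (m - 1)] at hand, the powers of
    [b 0 = t_2] cancel the denominators: [b (i + 1) * b 0 ^+ i = t_(i + 1)].
    For the pure Toeplitz matrices the convolution thus becomes the recurrence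
    that defines the Fibonacci polynomials, so they have permanents
    [F_(m + 1)] ([permanent_toeplitz]).  The first column of [lucas_mx] carries
    an extra factor [i + 1], and there the same convolution reads
    [\sum_i (i + 1) t_(i + 1) F_(n - i)], which is the Lucas polynomial. *)

(** * Laplace expansion of the permanent *)

Lemma permanent0 (C : comNzRingType) (A : 'M[C]_0) : permanent A = 1.
Proof.
rewrite /permanent; under eq_bigr do rewrite big_ord0.
by rewrite sumr_const card_Sn.
Qed.

(** Injectivity is read off from the values at [i0] and on the other points;
    bijectivity then follows by counting, as [n.+1 * n`! = n.+1`!]. *)
Lemma lift_perm_bij (n : nat) (i0 : 'I_n.+1) :
  bijective (fun p : 'I_n.+1 * 'S_n => lift_perm i0 p.1 p.2).
Proof.
apply: inj_card_bij => [[j s] [j' s'] /= eq_lift|]; last first.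
  by rewrite card_prod !card_Sn card_ord factS.
have eqj : j = j' by rewrite -(lift_perm_id i0 j s) eq_lift lift_perm_id.
congr (_, _) => //; apply/permP => k; apply: (@lift_inj _ j).
by rewrite -(lift_perm_lift i0) eq_lift lift_perm_lift eqj.
Qed.

Lemma permanent_expand_row (C : comNzRingType) (n : nat) (A : 'M[C]_n.+1)
    (i0 : 'I_n.+1) :
  permanent A = \sum_j A i0 j * permanent (row' i0 (col' j A)).
Proof.
rewrite {1}/permanent (reindex _ (onW_bij _ (lift_perm_bij i0))) /=.
rewrite -(pair_big xpredT xpredT (fun j s =>
  \prod_i A i (lift_perm i0 j s i))) /=.
apply: eq_bigr => j _; rewrite mulr_sumr; apply: eq_bigr => s _.
rewrite (bigD1_ord i0) //= lift_perm_id; congr (_ * _).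
by apply: eq_bigr => k _; rewrite lift_perm_lift !mxE.
Qed.

(** * Hessenberg matrices that are Toeplitz outside the first column *)

Definition hess_mx (C : nzRingType) (c b : nat -> C) (n : nat) : 'M[C]_n :=
  \matrix_(i, j) if j == 0%N :> nat then c i
                 else if (j <= i.+1)%N then b (i.+1 - j)%N else 0.

Lemma permanent_hess_mx1 (C : comNzRingType) (c b : nat -> C) :
  permanent (hess_mx c b 1) = c 0%N.
Proof.
by rewrite (permanent_expand_row _ ord0) big_ord1 permanent0 mulr1 mxE.
Qed.

(** Both minors that occur in the expansion along the first row are again of
    the form [hess_mx], with the same [b]. *)
Lemma permanent_hess_mxSS (C : comNzRingType) (c b : nat -> C) (n : nat) :
  permanent (hess_mx c b n.+2) =
    c 0%N * permanent (hess_mx (b \o succn) b n.+1)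
    + b 0%N * permanent (hess_mx (c \o succn) b n.+1).
Proof.
rewrite (permanent_expand_row _ ord0) 2!big_ord_recl big1 ?addr0 => [|j _].
  have -> : row' ord0 (col' ord0 (hess_mx c b n.+2)) =
            hess_mx (b \o succn) b n.+1.
    by apply/matrixP => i [[|j] ltj]; rewrite !mxE.
  have -> : row' ord0 (col' (lift ord0 ord0) (hess_mx c b n.+2)) =
            hess_mx (c \o succn) b n.+1.
    by apply/matrixP => i [[|j] ltj]; rewrite !mxE.
  by rewrite !mxE.
by rewrite mxE /= mul0r.
Qed.

(** The [i]-th term collects the permutations that send row [i] to the first
    column: they must send each row [r < i] to column [r + 1], whence the
    factor [b 0 ^+ i], and the rows below [i] carry a Toeplitz block. *)
Lemma permanent_hess_mx (C : comNzRingType) (c b : nat -> C) (n : nat) :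
  permanent (hess_mx c b n.+1) =
    \sum_(i < n.+1) c i * b 0%N ^+ i * permanent (hess_mx (b \o succn) b (n - i)).
Proof.
elim: n c => [|n IHn] c.
  by rewrite permanent_hess_mx1 big_ord1 permanent0 !mulr1.
rewrite permanent_hess_mxSS (IHn (c \o succn)) [RHS]big_ord_recl /= expr0 mulr1.
congr (_ + _); rewrite mulr_sumr; apply: eq_bigr => i _.
by rewrite exprS !mulrA (mulrC (b 0%N)).
Qed.

(** * Fibonacci and Lucas polynomials as permanents *)

Lemma coef_t_gt (C : comNzRingType) (k : nat) (t : k.-tuple C) (j : nat) :
  (k < j)%N -> coef_t t j = 0.
Proof. by move=> ltkj; rewrite /coef_t nth_default //= size_tuple. Qed.

(** The recurrences run over [j <= k], the permanent expansions over [i < n].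
    The two ranges agree since the coefficients vanish beyond [k] and the
    Fibonacci polynomials vanish at indices below 1: both sums equal the one
    over the common range [i < k + n]. *)
Lemma gfib_convolution (C : fieldType) (k : nat) (t : k.-tuple C)
    (f : nat -> C) (n : nat) :
    (forall j, (k < j)%N -> f j = 0) ->
  \sum_(1 <= j < k.+1) f j * gfib t (n%:Z - j%:Z + 1) =
  \sum_(i < n) f i.+1 * gfib t (n - i)%:Z.
Proof.
move=> f0; rewrite big_add1 succnK.
have widen m : (m <= k + n)%N ->
    (forall i, (m <= i)%N -> f i.+1 * gfib t (n%:Z - i%:Z) = 0) ->
  \sum_(0 <= i < m) f i.+1 * gfib t (n%:Z - i%:Z) =
  \sum_(0 <= i < k + n) f i.+1 * gfib t (n%:Z - i%:Z).
  move=> le_m z; rewrite [RHS](big_cat_nat (n := m)) //=.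
  rewrite [X in _ + X]big1_seq ?addr0 // => i /andP[_].
  by rewrite mem_index_iota => /andP[/z].
transitivity (\sum_(0 <= i < k + n) f i.+1 * gfib t (n%:Z - i%:Z)).
  rewrite -(widen k) ?leq_addr // => [|i ltki]; last by rewrite f0 ?mul0r.
  by apply: eq_bigr => i _; congr (_ * gfib t _); lia.
rewrite -(widen n) ?leq_addl // => [|i lei]; last first.
  by rewrite gfib_le0 ?mulr0 //; lia.
rewrite big_mkord; apply: eq_bigr => i _; congr (_ * gfib t _).
by have := ltn_ord i; lia.
Qed.

(** The integer exponent matters at [m = 0], where the value is [t_2]. *)
Definition scaled_coef (C : fieldType) (k : nat) (t : k.-tuple C) (m : nat) : C :=
  coef_t t m / coef_t t 2 ^ (m%:Z - 1).

Lemma scaled_coef0 (C : fieldType) (k : nat) (t : k.-tuple C) :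
  scaled_coef t 0 = coef_t t 2.
Proof. by rewrite /scaled_coef /coef_t /= mul1r invrK. Qed.

Lemma scaled_coefK (C : fieldType) (k : nat) (t : k.-tuple C) (i : nat) :
  coef_t t 2 != 0 -> scaled_coef t i.+1 * scaled_coef t 0 ^+ i = coef_t t i.+1.
Proof.
move=> t2_neq0; rewrite scaled_coef0 /scaled_coef.
have -> : i.+1%:Z - 1 = i by lia.
by rewrite -exprnP mulfVK // expf_neq0.
Qed.

(** Both sides satisfy the recurrence of the Fibonacci polynomials. *)
Lemma permanent_toeplitz (C : fieldType) (k : nat) (t : k.-tuple C) (n : nat) :
    coef_t t 2 != 0 ->
  permanent (hess_mx (scaled_coef t \o succn) (scaled_coef t) n) =
    gfib t n.+1%:Z.
Proof.
move=> t2_neq0; elim/ltn_ind: n => -[|n] IHn; first by rewrite permanent0.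
rewrite permanent_hess_mx.
have -> : n.+2%:Z = n.+1%:Z + 1 by lia.
rewrite gfibS // gfib_convolution; last exact: coef_t_gt.
apply: eq_bigr => i _; rewrite scaled_coefK // IHn ?ltnS ?leq_subr //.
by rewrite -subSn // -ltnS.
Qed.

Lemma lucas_mxE (C : fieldType) (k : nat) (t : k.-tuple C) (n : nat) :
  lucas_mx t n =
    hess_mx (fun i => scaled_coef t i.+1 * i.+1%:R) (scaled_coef t) n.
Proof.
apply/matrixP => i j; rewrite !mxE /scaled_coef.
have [leji|ltij] := leqP j i.+1; last first.
  by rewrite ifF ?[in RHS]ifF //; [apply/negbTE|]; lia.
(* Below the band, [hess_mx] has no explicit cut-off: its entries are zero
   because the coefficients of index above [k] are. *)
have [ltijk|lekij] := ltnP (i.+1 - j) k.+1; last first.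
  rewrite coef_t_gt //= !mul0r !if_same.
  by case: ifP => // /eqP j0; rewrite coef_t_gt ?mul0r //; lia.
rewrite ifT; last by lia.
case: ifP => [/eqP ->|_].
  by rewrite subn0; congr (_ / _ ^ _ * _); lia.
by congr (_ / _ ^ _); lia.
Qed.

Lemma permanent_lucas_mx (C : fieldType) (k : nat) (t : k.-tuple C) (n : nat) :
  coef_t t 2 != 0 -> (1 <= n)%N -> permanent (lucas_mx t n) = glucas t n.
Proof.
case: n => [//|n] t2_neq0 _; rewrite lucas_mxE permanent_hess_mx /glucas /=.
rewrite gfib_convolution => [|j ltkj]; last by rewrite coef_t_gt ?mulr0.
apply: eq_bigr => i _; rewrite permanent_toeplitz // (mulrAC (scaled_coef _ _)).
by rewrite scaled_coefK // (mulrC (coef_t _ _)) -subSn // -ltnS.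
Qed.

Theorem theorem3p4 (R : realType) (k n : nat) (hk : (2 <= k)%N) (hn : (1 <= n)%N)
    (t : k.-tuple R[i]) (ht2 : coef_t t 2 != 0) :
  permanent (lucas_mx t n) = glucas t n.
Proof. exact: permanent_lucas_mx. Qed.
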